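(* Let $(\mathfrak{g},[-,-],P)$ be a Rota-Baxter Lie algebra of weight zero and $(\mathfrak g,\circ)$ be the induced pre-Lie algebra, $x\circ y=[P(x),y]$. If there is an invariant bilinear form $\mathcal{B}$ on the Lie algebra $(\mathfrak{g},[-,-])$, then $\mathcal{B}$ is left-invariant on the pre-Lie algebra $(\mathfrak{g},\circ)$.
   Context: All vector spaces and algebras are finite-dimensional over a field of characteristic zero. A Rota-Baxter Lie algebra of weight zero is $(\mathfrak{g},[-,-],P)$ with $(\mathfrak g,[-,-])$ a Lie algebra and $P$ linear with $[P(x),P(y)]=P([x,P(y)])+P([P(x),y])$; the operation $x\circ y=[P(x),y]$ is then pre-Lie, i.e. $(x\circ y)\circ z-x\circ(y\circ z)=(y\circ x)\circ z-y\circ(x\circ z)$. A bilinear form $\mathcal B$ (not assumed symmetric) on a Lie algebra is invariant if $\mathcal{B}([x,y],z)=\mathcal{B}(x,[y,z])$ for all $x,y,z$; a bilinear form $\mathcal B$ on a pre-Lie algebra is left-invariant if $\mathcal{B}(x\circ y,z)+\mathcal{B}(y, x\circ z)=0$ for all $x,y,z$. *)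

(* Defs.v *)
From HB Require Import structures.
From mathcomp Require Import all_boot all_order all_algebra.
From mathcomp Require Import sesquilinear.

Set Implicit Arguments.
Unset Strict Implicit.
Unset Printing Implicit Defensive.

Import GRing.Theory.
Local Open Scope ring_scope.

Record lieAlgebra (F : fieldType) := LieAlgebra {
  lie_space :> vectType F;
  lie_bracket : {bilinear lie_space -> lie_space -> lie_space};
  lie_bracket_alt : forall x, lie_bracket x x = 0;
  lie_bracket_jacobi : forall x y z,
    lie_bracket x (lie_bracket y z) + lie_bracket y (lie_bracket z x)
      + lie_bracket z (lie_bracket x y) = 0 }.

(* Rota-Baxter operators are of weight zero throughout. *)
Record rotaBaxterLieAlgebra (F : fieldType) := RotaBaxterLieAlgebra {
  rb_lie :> lieAlgebra F;
  rb_op : {linear rb_lie -> rb_lie};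
  rb_opP : forall x y,
    lie_bracket rb_lie (rb_op x) (rb_op y) =
      rb_op (lie_bracket rb_lie x (rb_op y))
        + rb_op (lie_bracket rb_lie (rb_op x) y) }.

Record preLieAlgebra (F : fieldType) := PreLieAlgebra {
  prelie_space :> vectType F;
  prelie_mul : {bilinear prelie_space -> prelie_space -> prelie_space};
  prelie_mulP : forall x y z,
    prelie_mul (prelie_mul x y) z - prelie_mul x (prelie_mul y z) =
      prelie_mul (prelie_mul y x) z - prelie_mul y (prelie_mul x z) }.

Section LieTheory.
Variables (F : fieldType) (g : lieAlgebra F).
Local Notation br := (lie_bracket g).

Lemma lie_bracketC (x y : g) : br x y = - br y x.
Proof.
apply/eqP; rewrite -addr_eq0; apply/eqP.
have := lie_bracket_alt (x + y).
by rewrite linearDl !linearDr /= !lie_bracket_alt add0r addr0.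
Qed.

Lemma lie_bracket_leibniz (x y z : g) :
  br (br x y) z = br x (br y z) - br y (br x z).
Proof.
have := lie_bracket_jacobi x y z.
rewrite (lie_bracketC z (br x y)) (lie_bracketC z x) linearNr /=.
by move/eqP; rewrite subr_eq0 => /eqP <-.
Qed.

End LieTheory.

Section InducedPreLie.
Variables (F : fieldType) (g : rotaBaxterLieAlgebra F).
Local Notation br := (lie_bracket g).
Local Notation P := (rb_op g).

Definition induced_mul (x y : g) : g := br (P x) y.

Fact induced_mul_bilinear : bilinear_for *:%R *:%R induced_mul.
Proof.
split=> [y a x x' | x a y y']; rewrite /induced_mul.
  by rewrite linearP linearPl.
by rewrite linearPr.
Qed.

HB.instance Definition _ :=
  bilinear_isBilinear.Build F g g g *:%R *:%R induced_mul induced_mul_bilinear.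

Fact induced_mulP (x y z : g) :
  induced_mul (induced_mul x y) z - induced_mul x (induced_mul y z) =
    induced_mul (induced_mul y x) z - induced_mul y (induced_mul x z).
Proof.
rewrite /induced_mul.
have -> : P (br (P x) y) = br (P x) (P y) + P (br (P y) x).
  by rewrite rb_opP (lie_bracketC (P y)) linearN addrAC subrr add0r.
rewrite linearDl /= lie_bracket_leibniz.
by rewrite addrAC (addrAC (br _ _)) subrr add0r addrC.
Qed.

Definition induced_preLie : preLieAlgebra F :=
  @PreLieAlgebra F g induced_mul induced_mulP.

End InducedPreLie.

Definition lie_invariant (F : fieldType) (g : lieAlgebra F)
    (B : {biscalar g}) : Prop :=
  forall x y z : g, B (lie_bracket g x y) z = B x (lie_bracket g y z).

Definition left_invariant (F : fieldType) (A : preLieAlgebra F)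
    (B : {biscalar A}) : Prop :=
  forall x y z : A, B (prelie_mul A x y) z + B y (prelie_mul A x z) = 0.

(* Main.v *)
Require Import Defs.
From mathcomp Require Import all_boot all_order all_algebra.
From mathcomp Require Import sesquilinear.

Local Open Scope ring_scope.

(** Antisymmetry and invariance make every adjoint map skew for [B]: B([u,y],z) = -B([y,u],z) =
    -B(y,[u,z]). Left multiplication by x in the induced pre-Lie algebra is the adjoint map of P(x),
    so left-invariance is the case u = P(x). *)

Theorem proposition2p11 (F : fieldType) (charF0 : [pchar F] =i pred0)
    (g : rotaBaxterLieAlgebra F) (B : {biscalar g}) :
  lie_invariant B -> @left_invariant F (induced_preLie g) B.
Proof.
move=> invB x y z.
(* The swap puts [rb_op g x] in the inner slot, from which [invB] carries it over to [z]. *)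
rewrite /= /induced_mul lie_bracketC linearNl /= invB.
exact: GRing.addNr.
Qed.
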